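(* Let $R$ be a Euclidean ring with Euclidean function $\nu$, and let $\tau\mapsto\overline{\tau}$ be an anti-automorphism of $R$ satisfying: (i) $\tau\overline{\tau}=\overline{\tau}\tau$ for all $\tau\in R$; (ii) if $\overline{\tau}=\tau$ then $\tau$ lies in the centre of $R$. Suppose $m\in R$ admits a proper representation $m=x\overline{x}+y\overline{y}$, i.e. with $x,y\in R$ and $Rx+Ry=R$. Then there exists $z\in R$ with $z\overline{z}+1\in Rm$. Furthermore, if $y\neq 0$ and the Euclidean algorithm applied to $(x,y)$ produces the quotient sequence $(q_1,\ldots,q_s)$ ($s\ge1$) and a last nonzero remainder $u$ (a unit), so that $x=[q_1,\ldots,q_s]u$ and $y=[q_2,\ldots,q_s]u$, then $z=[\overline{q_s},\ldots,\overline{q_1},q_1,\ldots,q_{s-1}]$ satisfies $z\overline{z}+1\in Rm$.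
   Context: A Euclidean ring is a ring $R$ (with identity) without zero divisors, endowed with a function $\nu:R\to\mathbb{Z}_{\ge0}$ such that for all $\tau_1,\tau_2\in R$ with $\tau_1\neq0$ there exist $q,r\in R$ with $\tau_2=q\tau_1+r$ and $\nu(r)<\nu(\tau_1)$. The Euclidean algorithm on $(\tau_1,\tau_2)$: while $\tau_2\ne0$, write $\tau_1=q\tau_2+t$ with $\nu(t)<\nu(\tau_2)$, record $q$ as the next quotient, and replace $(\tau_1,\tau_2)$ by $(\tau_2,t)$; it outputs the final $\tau_1$ (the last nonzero remainder) and the recorded quotients $(q_1,q_2,\ldots)$. $Rx$ denotes the left ideal generated by $x$. Continuants: $[\,]=1$, $[q_1]=q_1$, $[q_1,q_2]=q_1q_2+1$, $[q_1,\ldots,q_n]=[q_1,\ldots,q_{n-1}]q_n+[q_1,\ldots,q_{n-2}]$ for $n\ge3$. An anti-automorphism is an involution $\tau\mapsto\overline\tau$ with $\overline{\tau+\sigma}=\overline\tau+\overline\sigma$ and $\overline{\tau\sigma}=\overline\sigma\,\overline\tau$. *)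

(* Defs.v *)
From mathcomp Require Import all_boot all_algebra.

Set Implicit Arguments.
Unset Strict Implicit.
Unset Printing Implicit Defensive.

Import GRing.Theory.
Local Open Scope ring_scope.

Section EuclideanRing.
Variable R : pzRingType.
Implicit Types (x y u : R) (qs : seq R) (nu : R -> nat) (bar : R -> R).

Definition no_zero_divisors : Prop :=
  forall a b : R, a * b = 0 -> a = 0 \/ b = 0.

(* No further axiom on [nu] is assumed; in particular no monotonicity. *)
Definition is_euclidean nu : Prop :=
  no_zero_divisors /\
  forall t1 t2 : R, t1 != 0 ->
    exists q r : R, t2 = q * t1 + r /\ (nu r < nu t1)%N.

(* [bar 1 = 1] and [bar 0 = 0] follow from these clauses. *)
Definition is_antiautomorphism bar : Prop :=
  [/\ involutive bar,
      {morph bar : x y / x + y}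
    & forall x y, bar (x * y) = bar y * bar x].

Definition is_central x : Prop := forall a : R, x * a = a * x.

Definition is_unit u : Prop := exists v : R, v * u = 1 /\ u * v = 1.

Definition left_ideal x : R -> Prop := fun w => exists a : R, w = a * x.

Definition left_ideal_sum (I J : R -> Prop) : R -> Prop :=
  fun w => exists a b : R, [/\ I a, J b & w = a + b].

(* The quotient and remainder of a division step need not be unique, so the
   algorithm is a relation: [euclid_run nu x y qs u] says that some run on
   [(x, y)] records the quotients [qs] and outputs [u]. *)
Inductive euclid_run nu : R -> R -> seq R -> R -> Prop :=
| euclid_stop x : euclid_run nu x 0 [::] x
| euclid_step x y q t qs u :
    y != 0 -> x = q * y + t -> (nu t < nu y)%N ->
    euclid_run nu y t qs u -> euclid_run nu x y (q :: qs) u.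

(* The continuant recursion peels off the last entry, so it is run on the
   reversed sequence. *)
Fixpoint continuant_rev qs : R :=
  match qs with
  | [::] => 1
  | q :: qs1 =>
    match qs1 with
    | [::] => q
    | _ :: qs2 => continuant_rev qs1 * q + continuant_rev qs2
    end
  end.

Definition continuant qs : R := continuant_rev (rev qs).

End EuclideanRing.

(* Main.v *)
(* For a bar-palindromic sequence P = rev (map bar l) ++ l the continuant [P]
   is fixed by bar, hence central, and induction on l gives Euler's identity
   [bar q, P, q][P] = [bar q, P][P, q] + 1, where [P, q] = bar [bar q, P].
   When x = [qs] u and y = [behead qs] u, the continuant product formula shows
   m = bar u * [rev (map bar qs) ++ qs] * u, so m generates the same left ideal
   as that continuant, and Euler's identity exhibits z * bar z + 1 in it. *)
Require Import Defs.
From mathcomp Require Import all_boot all_algebra.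
From mathcomp Require Import zify.

Set Implicit Arguments.
Unset Strict Implicit.
Unset Printing Implicit Defensive.

Import GRing.Theory.
Local Open Scope ring_scope.

Section Continuants.
Variable R : pzRingType.
Implicit Types (p q : R) (l : seq R).

Lemma continuant_rcons2 l p q :
  continuant (rcons (rcons l p) q) = continuant (rcons l p) * q + continuant l.
Proof. by rewrite /continuant !rev_rcons. Qed.

(** The recursion also runs from the left end: expanding both sides at the right end reduces the
    claim to shorter sequences. A one-entry [l] is a base case of its own, since [continuant l] then
    has no further expansion. *)
Lemma continuant_cons2 p q l :
  continuant (p :: q :: l) = p * continuant (q :: l) + continuant l.
Proof.
have [n] := ubnP (size l); elim: n l => // n IHn l.
case/lastP: l => [|l a] //; case/lastP: l => [|l b].
  by rewrite /continuant /= mulrDl mul1r mulrDr mulr1 mulrA addrAC.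
rewrite !size_rcons => lt_l.
have -> : p :: q :: rcons (rcons l b) a = rcons (rcons (p :: q :: l) b) a by [].
have -> : q :: rcons (rcons l b) a = rcons (rcons (q :: l) b) a by [].
rewrite !continuant_rcons2 !rcons_cons !IHn ?size_rcons //; last by lia.
by rewrite mulrDl mulrDr -!addrA mulrA; congr (_ + _); rewrite addrCA.
Qed.

(** Both sides obey the same left recursion in the prefix [rcons l p], so it suffices to check
    prefixes of length one and two. *)
Lemma continuant_cat l p q l' :
  continuant (rcons l p ++ q :: l') =
    continuant (rcons l p) * continuant (q :: l') + continuant l * continuant l'.
Proof.
have [n] := ubnP (size l); elim: n l => // n IHn [|a [|b l]] lt_l.
- by rewrite /= continuant_cons2 [continuant [::]]/= mul1r.
- rewrite /= 3!continuant_cons2 [continuant [:: p]]/= [continuant [:: a]]/=.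
  by rewrite [continuant [::]]/= mulrDl mulrDr mul1r mulrA addrAC.
rewrite /= in lt_l.
rewrite !rcons_cons !cat_cons !continuant_cons2 -!cat_cons -!rcons_cons.
rewrite !IHn /=; [|by lia|by lia].
by rewrite !mulrDl mulrDr !mulrA addrACA.
Qed.

End Continuants.

Section AntiAutomorphism.
Variables (R : pzRingType) (bar : R -> R).
Hypothesis hbar : is_antiautomorphism bar.
Implicit Types (p q : R) (l : seq R).

Let barK : involutive bar. Proof. by case: hbar. Qed.
Let barD : {morph bar : x y / x + y}. Proof. by case: hbar. Qed.
Let barM x y : bar (x * y) = bar y * bar x. Proof. by case: hbar. Qed.

Lemma bar1 : bar 1 = 1.
Proof. by rewrite -[LHS]mulr1 -{2}[1]barK -barM mulr1 barK. Qed.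

Definition bar_rev l : seq R := rev [seq bar q | q <- l].

Lemma bar_rev_cons q l : bar_rev (q :: l) = rcons (bar_rev l) (bar q).
Proof. by rewrite /bar_rev map_cons rev_cons. Qed.

Lemma bar_rev_rcons l q : bar_rev (rcons l q) = bar q :: bar_rev l.
Proof. by rewrite /bar_rev map_rcons rev_rcons. Qed.

Lemma bar_rev_cat l l' : bar_rev (l ++ l') = bar_rev l' ++ bar_rev l.
Proof. by rewrite /bar_rev map_cat rev_cat. Qed.

Lemma bar_revK : involutive bar_rev.
Proof. by move=> l; rewrite /bar_rev map_rev revK mapK. Qed.

(** Because [bar] reverses products, it exchanges the left and right recursions. *)
Lemma continuant_bar_rev l : continuant (bar_rev l) = bar (continuant l).
Proof.
have [n] := ubnP (size l); elim: n l => // n IHn [|p [|q l]] /= lt_l.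
- by rewrite [continuant _]/= bar1.
- by [].
rewrite continuant_cons2 barD barM -!IHn /=; [|by lia|by lia].
by rewrite !bar_rev_cons continuant_rcons2.
Qed.

Definition bar_palindrome l : seq R := bar_rev l ++ l.

Lemma bar_palindrome_rcons l q :
  bar_palindrome (rcons l q) = bar q :: rcons (bar_palindrome l) q.
Proof. by rewrite /bar_palindrome bar_rev_rcons cat_cons rcons_cat. Qed.

Lemma bar_rev_palindrome l : bar_rev (bar_palindrome l) = bar_palindrome l.
Proof. by rewrite bar_rev_cat bar_revK. Qed.

Lemma bar_continuant_palindrome l :
  bar (continuant (bar_palindrome l)) = continuant (bar_palindrome l).
Proof. by rewrite -continuant_bar_rev bar_rev_palindrome. Qed.

Lemma bar_continuant_cons_palindrome q l :
  bar (continuant (bar q :: bar_palindrome l)) =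
    continuant (rcons (bar_palindrome l) q).
Proof.
by rewrite -continuant_bar_rev bar_rev_cons bar_rev_palindrome barK.
Qed.

(** The product formula, cut at the centre of the palindrome; up to the unit [u] this is the shape
    of [m]. *)
Lemma continuant_palindrome_cons q l :
  continuant (bar_palindrome (q :: l)) =
    bar (continuant (q :: l)) * continuant (q :: l)
    + bar (continuant l) * continuant l.
Proof.
by rewrite /bar_palindrome bar_rev_cons continuant_cat -bar_rev_cons
  !continuant_bar_rev.
Qed.

Hypothesis hnormal : forall t : R, t * bar t = bar t * t.
Hypothesis hcentral : forall t : R, bar t = t -> is_central t.

Lemma continuant_palindrome_central l :
  is_central (continuant (bar_palindrome l)).
Proof. exact/hcentral/bar_continuant_palindrome. Qed.

Lemma continuant_palindrome_euler l q :
  let P := bar_palindrome l in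
  continuant (bar q :: rcons P q) * continuant P =
    continuant (bar q :: P) * continuant (rcons P q) + 1.
Proof.
(* Appending an entry to [l] wraps the palindrome on both sides, hence induction from the right
   end. *)
elim/last_ind: l q => [|l p IHl] q /=.
  by rewrite continuant_cons2 [continuant [::]]/= mulr1.
(* Normality turns the product [z * z'] of the induction hypothesis into [z' * z], the order
   produced by expanding the goal. *)
have zC := hnormal (continuant (bar p :: bar_palindrome l)).
rewrite bar_continuant_cons_palindrome in zC.
have nC := continuant_palindrome_central (rcons l p).
move: (IHl p) nC; rewrite bar_palindrome_rcons.
rewrite rcons_cons !continuant_cons2 -!rcons_cons !continuant_rcons2 rcons_cons.
move: zC; set z := continuant (_ :: _); set z' := continuant (rcons _ _).
set n := continuant (_ :: _); set k := continuant _ => zC nk nC.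
rewrite /= -/n -/k zC in nk.
(* As [n] is central, the terms containing [q] or [bar q] match, which leaves
   [n * k = z' * z + 1]. *)
by rewrite -nC !mulrDr !mulrDl nk !mulrA !(nC (bar q), nC z') !addrA
  (addrAC (bar q * n * n * q)).
Qed.

End AntiAutomorphism.

Section EuclideanAlgorithm.
Variables (R : pzRingType) (nu : R -> nat).
Implicit Types (x y u : R) (qs : seq R).

(** Cancel [u] in [(u * a - 1) * u = 0]; if instead [u = 0], then [1 = 0] and the ring is
    trivial. *)
Lemma left_inverse_is_unit a u : no_zero_divisors R -> a * u = 1 -> is_unit u.
Proof.
move=> nzd au1; exists a; split=> //.
have /nzd[/eqP|u0] : (u * a - 1) * u = 0.
  by rewrite mulrBl -mulrA au1 mulr1 mul1r subrr.
  by rewrite subr_eq0 => /eqP.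
by rewrite -[LHS]mulr1 -au1 u0 !(mulr0, mul0r).
Qed.

Lemma euclid_run_exists x y :
  is_euclidean nu -> exists qs u, euclid_run nu x y qs u.
Proof.
case=> _ division.
have [n] := ubnP (nu y); elim: n x y => // n IHn x y lt_y.
have [->|y0] := eqVneq y 0; first by exists [::], x; constructor.
have [q [t [def_x lt_t]]] := division y x y0.
have [|qs [u run]] := IHn y t; first by lia.
by exists (q :: qs), u; apply: euclid_step run.
Qed.

(** Read backwards, each division [x = q * y + t] is one step of the left recursion. The value 0
    covers a run that stops at once. *)
Lemma euclid_run_continuant x y qs u : euclid_run nu x y qs u ->
  x = continuant qs * u /\
  y = if qs is _ :: qs' then continuant qs' * u else 0.
Proof.
elim=> {x y qs u} [x|x y q t qs u _ -> _ _ [-> ->]]; first by rewrite mul1r.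
case: qs => [|p qs]; first by rewrite addr0 mul1r.
by rewrite continuant_cons2 mulrDl mulrA.
Qed.

(** A division step turns the relation into [(a * q + b) * y + a * t = 1]; at the final pair
    [(u, 0)] the first coefficient is a left inverse of [u]. *)
Lemma euclid_run_bezout x y qs u : euclid_run nu x y qs u ->
  forall a b, a * x + b * y = 1 -> exists c, c * u = 1.
Proof.
elim=> {x y qs u} [x|x y q t qs u _ -> _ _ IH] a b.
  by rewrite mulr0 addr0 => <-; exists a.
by rewrite mulrDr mulrA addrAC -mulrDl; apply: IH.
Qed.

End EuclideanAlgorithm.

Lemma left_ideal_continuant_palindrome (R : pzRingType) (bar : R -> R) :
  is_antiautomorphism bar ->
  (forall t : R, t * bar t = bar t * t) ->
  (forall t : R, bar t = t -> is_central t) ->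
  forall (q : R) (l : seq R) (u : R), is_unit u ->
  let x := continuant (q :: l) * u in
  let y := continuant l * u in
  let z := continuant (bar_rev bar (q :: l) ++ take (size l) (q :: l)) in
  left_ideal (x * bar x + y * bar y) (z * bar z + 1).
Proof.
move=> hbar hnormal hcentral q l u [v [vu1 uv1]] x y z.
have [_ _ barM] := hbar.
pose n := continuant (bar_palindrome bar (q :: l)).
have nC : is_central n by apply: continuant_palindrome_central.
(* Normality puts the barred factors first, so [bar u] and [u] enclose [n], which is central. *)
have -> : x * bar x + y * bar y = bar u * u * n.
  rewrite !hnormal !barM -!mulrA -(nC u) /n (continuant_palindrome_cons hbar).
  by rewrite mulrDl mulrDr !mulrA.
have [k nk] : exists k, z * bar z + 1 = k * n.
  (* Once [q :: l] is split as [rcons l' p], this size equation shows that truncation leaves [l'],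
     so [z] is a factor in Euler's identity. *)
  have: size (q :: l) = (size l).+1 by [].
  rewrite /z /n; case/lastP: (q :: l) => // l' p.
  rewrite size_rcons => -[<-]; rewrite -cats1 take_size_cat // cats1.
  rewrite bar_rev_rcons bar_palindrome_rcons cat_cons.
  exists (continuant (bar_palindrome bar l')).
  rewrite (bar_continuant_cons_palindrome hbar) -continuant_palindrome_euler //.
  exact/esym/continuant_palindrome_central.
(* The factor [v * bar v] undoes [bar u * u]: [v * bar (u * v) * u = 1]. *)
exists (k * v * bar v); rewrite nk -!mulrA; congr (_ * _).
by rewrite (mulrA (bar v)) -barM uv1 (bar1 hbar) mul1r mulrA vu1 mul1r.
Qed.

Theorem theorem1 (R : pzRingType) (nu : R -> nat) (bar : R -> R)
    (hR : is_euclidean nu)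
    (hbar : is_antiautomorphism bar)
    (hnormal : forall t : R, t * bar t = bar t * t)
    (hcentral : forall t : R, bar t = t -> is_central t)
    (m x y : R)
    (hm : m = x * bar x + y * bar y)
    (hproper : forall w : R, left_ideal_sum (left_ideal x) (left_ideal y) w) :
  (exists z : R, left_ideal m (z * bar z + 1)) /\
  (y != 0 ->
   forall (qs : seq R) (u : R), euclid_run nu x y qs u ->
     let z := continuant (rev [seq bar q | q <- qs] ++ take (size qs).-1 qs) in
     [/\ (1 <= size qs)%N,
         is_unit u,
         x = continuant qs * u,
         y = continuant (behead qs) * u
       & left_ideal m (z * bar z + 1)]).
Proof.
have [nzd _] := hR.
have [_ [_ [[a ->] [b ->] /esym bezout]]] := hproper 1.
have algorithm qs u : y != 0 -> euclid_run nu x y qs u ->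
    let z := continuant (rev [seq bar q | q <- qs] ++ take (size qs).-1 qs) in
    [/\ (1 <= size qs)%N, is_unit u, x = continuant qs * u,
        y = continuant (behead qs) * u & left_ideal m (z * bar z + 1)].
  move=> y0 run; have [c cu1] := euclid_run_bezout run bezout.
  have uU := left_inverse_is_unit nzd cu1.
  have [def_x] := euclid_run_continuant run.
  (* An empty quotient sequence would force [y = 0]. *)
  case: qs => [|q l] in def_x {run} * => [/eqP|def_y]; first by rewrite (negPf y0).
  split=> //; rewrite hm def_x def_y.
  exact: (left_ideal_continuant_palindrome hbar hnormal hcentral).
split; last by move=> y0 qs u; apply: algorithm.
have [y0|y0] := eqVneq y 0; last first.
  have [qs [u run]] := euclid_run_exists x y hR.
  by have [_ _ _ _ mz] := algorithm qs u y0 run; eexists; apply: mz.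
have [_ _ barM] := hbar.
move: bezout; rewrite y0 mulr0 addr0 => ax1.
(* With [y = 0], [x] is a unit with inverse [a], so [m] is a unit and any [z] would do: [a * bar a *
   (bar x * x) = a * bar (x * a) * x = 1]. *)
exists 0, (a * bar a).
rewrite hm y0 (hnormal x) !mul0r add0r addr0 -mulrA (mulrA (bar a)) -barM.
have [v [vx1 xv1]] := left_inverse_is_unit nzd ax1.
have -> : a = v by rewrite -[a]mulr1 -xv1 mulrA ax1 mul1r.
by rewrite xv1 (bar1 hbar) mul1r.
Qed.
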